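(* Let $N$ be an integer with $N\geq 25$. Then $$\| K^{\ddagger , N}\|^2 < \left( 2\sqrt{\log N} + \left( 1 + \frac{1}{\sqrt{N}}\right)^{8} \left( \tfrac{4}{9} + \tfrac{23}{30} N^{-1/6}\right) + \frac{\log\log(N) + 9}{\sqrt{\log N}}\right) N^{-1/2}.$$
   Context: Let $K:[0,1]\times[0,1]\to\mathbb{R}$ be defined by $K(x,y)=\tfrac12-\{1/(xy)\}$ for $0<x,y\leq 1$ and $K(x,0)=K(0,x)=0$ for $0\le x\le 1$, where $\{\alpha\}=\alpha-\lfloor\alpha\rfloor$ is the fractional part. For $N\in\mathbb{N}$ let $K^{\dagger,N}(x,y)=\tfrac12-\left\{N^2/(\lceil Nx\rceil\lceil Ny\rceil)\right\}$ for $0<x,y\le 1$ and $K^{\dagger,N}(x,y)=0$ if $0\le x,y\le 1$ and $xy=0$. Put $K^{\ddagger,N}=K-K^{\dagger,N}$. For a kernel $K^*$ on $[0,1]^2$, $\|K^*\|=\left(\int_0^1\int_0^1 K^*(x,y)^2\,dx\,dy\right)^{1/2}$. *)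

(* Defs.v *)
From HB Require Import structures.
From mathcomp Require Import all_boot all_order all_algebra.
From mathcomp Require Import all_classical all_reals all_analysis.

Set Implicit Arguments.
Unset Strict Implicit.
Unset Printing Implicit Defensive.

Import Order.TTheory GRing.Theory Num.Theory.

Local Open Scope classical_set_scope.
Local Open Scope ring_scope.

Definition frac_part (R : realType) (a : R) : R := a - (Num.floor a)%:~R.

(* Kernels are total functions on R x R of which only the values on
   [0, 1] x [0, 1] are ever used: kernel_norm integrates over that square. *)
Definition kernelK (R : realType) (x y : R) : R :=
  if (0 < x) && (0 < y) then 2^-1 - frac_part (1 / (x * y)) else 0.

Definition kernelK_dagger (R : realType) (N : nat) (x y : R) : R :=
  if (0 < x) && (0 < y) then
    2^-1 - frac_part
      (N%:R ^+ 2 / ((Num.ceil (N%:R * x))%:~R * (Num.ceil (N%:R * y))%:~R))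
  else 0.

Definition kernelK_ddagger (R : realType) (N : nat) (x y : R) : R :=
  kernelK x y - kernelK_dagger N x y.

(* The integrals are extended-real Lebesgue integrals, so that an upper bound
   on the norm also asserts that the norm is finite. *)
Definition kernel_norm (R : realType) (K : R -> R -> R) : \bar R :=
  ((\int[lebesgue_measure]_(y in `[0%R, 1%R])
      \int[lebesgue_measure]_(x in `[0%R, 1%R]) (K x y ^+ 2)%:E) `^ 2^-1)%E.

(* Main.v *)
(* Write u = 1/(xy) and let v be the value of u at the upper right corner of
   the N^-1-cell of (x, y), so that the integrand is (frac u - frac v)^2 <= 1.
   The bound proved is 20 sqrt 2 / 3 * N^(-1/2), with no logarithm.  Passing
   from v to the value w at the lower left corner one coordinate at a time,
   the integrand on a cell is at most the sum over the two steps of (number of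
   integers crossed) + 2 (increment)^2.  In one step, along a row of cells with
   the other coordinate equal to q / N, the values are X / i with X = N^2 / q;
   using the trivial bound 1 for i^2 < 2 X and telescoping beyond, the row
   contributes at most 5/3 sqrt (2 X) + 1, and the sum over q is of order
   N^(3/2).  The AM-GM inequality 2 s + a / s >= sqrt (8 a), s = sqrt (log N),
   shows that the claimed bound exceeds this one for N >= 81, and exceeds the
   trivial bound 1 for smaller N. *)

Require Import Defs.
From HB Require Import structures.
From mathcomp Require Import all_boot all_order all_algebra.
From mathcomp Require Import all_classical all_reals all_analysis.
From mathcomp Require Import measurable_realfun.
From mathcomp Require Import ring lra.

Import Order.TTheory GRing.Theory Num.Theory.

Local Open Scope ring_scope.

(** * Integrals over the unit interval bounded cell by cell *)

(* Unlike [ge0_le_integral], no measurability is assumed: the inner integral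
   of the kernel is never shown to be measurable. *)
Lemma ge0_integral_monotone (d : measure_display) (T : measurableType d)
    (R : realType) (mu : {measure set T -> \bar R}) (D : set T)
    (f g : T -> \bar R) :
  (forall x, D x -> (0 <= f x)%E) -> (forall x, D x -> (f x <= g x)%E) ->
  (\int[mu]_(x in D) f x <= \int[mu]_(x in D) g x)%E.
Proof.
move=> f0 fg; have g0 x (Dx : D x) := le_trans (f0 x Dx) (fg x Dx).
rewrite !ge0_integralE//; apply: le_ereal_sup => _ [h hf <-].
by exists h => // x; apply: le_trans (hf x) _; exact: lee_restrict.
Qed.

Lemma unit_itv_cell (R : realType) (N : nat) (x : R) : (0 < N)%N ->
  0 < x <= 1 -> exists2 i : 'I_N, Num.ceil (N%:R * x) = i.+1 &
    i%:R / N%:R < x <= i.+1%:R / N%:R.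
Proof.
move=> N0 /andP[x0 x1]; have NR : 0 < N%:R :> R by rewrite ltr0n.
have /andP[] := ceil_itv (N%:R * x).
case E : (Num.ceil (N%:R * x)) => [[|i]|i].
- by move=> _ /(lt_le_trans (mulr_gt0 NR x0)); rewrite ltxx.
- rewrite (_ : (i.+1%:Z - 1)%:~R = i%:R :> R); last first.
    by rewrite intrD -[i.+1]addn1 PoszD intrD addrK.
  move=> lo hi; have iN : (i < N)%N.
    rewrite -(ltr_nat R); apply: lt_le_trans lo _.
    by rewrite -[leRHS]mulr1 ler_pM2l.
  exists (Ordinal iN) => //=.
  by rewrite ltr_pdivrMr// ler_pdivlMr// ![x * _]mulrC lo hi.
- move=> _ /(lt_le_trans (mulr_gt0 NR x0)).
  by rewrite NegzE mulrNz oppr_gt0 ltNge ler0n.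
Qed.

(** The half-open cells cover all of [0, 1] except 0, where [g] vanishes, so [g] lies below a finite
    sum of multiples of indicators, each of a set of measure at most [1 / N]. *)
Lemma integral_unit_itv_step_le (R : realType) (N : nat) (g : R -> \bar R)
    (c : nat -> R) : (0 < N)%N ->
  (forall x, (0 <= g x)%E) -> g 0 = 0%E -> (forall i, 0 <= c i) ->
  (forall (i : 'I_N) x, i%:R / N%:R < x <= i.+1%:R / N%:R ->
     (g x <= (c i)%:E)%E) ->
  (\int[lebesgue_measure]_(x in `[0%R, 1%R]%classic) g x
     <= ((\sum_(i < N) c i) / N%:R)%:E)%E.
Proof.
move=> N0 g0 gz c0 gc; have NR : 0 < N%:R :> R by rewrite ltr0n.
pose A (i : 'I_N) : set R := `]i%:R / N%:R, (i.+1%:R / N%:R)]%classic.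
have mA i : measurable (A i) by exact: measurable_itv.
pose s (i : 'I_N) (x : R) : \bar R := ((c i)%:E * (\1_(A i) x)%:E)%E.
have s0 i x : (0 <= s i x)%E by rewrite mule_ge0 ?lee_fin.
have m1 i : measurable_fun (`[0, 1]%classic : set R)
      (EFin \o \1_(A i)).
  by apply/measurable_EFinP; exact: measurable_indic.
apply: (@le_trans _ _ (\int[lebesgue_measure]_(x in `[0%R, 1%R]%classic)
    \sum_(i < N) s i x)%E).
  apply: ge0_integral_monotone => // x; rewrite /= in_itv/= => /andP[x0 x1].
  have [->|xn0] := eqVneq x 0; first by rewrite gz sume_ge0.
  have [|i _ xi] := @unit_itv_cell R N x N0.
    by rewrite lt_neqAle eq_sym xn0 x0.
  apply: le_trans (gc i x xi) _; rewrite (bigD1 i)//=.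
  rewrite {1}/s indicE mem_set/= ?mule1; last by rewrite /A/= in_itv.
  by rewrite leeDl// sume_ge0.
rewrite ge0_integral_sum//; last first.
  by move=> i; apply: measurable_funeM; exact: m1.
rewrite mulr_suml -sumEFin; apply: lee_sum => i _.
rewrite /s ge0_integralZl_EFin//; last exact: m1.
rewrite integral_indic//; last exact: mA.
rewrite EFinM lee_wpmul2l ?lee_fin//.
apply: (@le_trans _ _ (lebesgue_measure (A i))).
  apply: le_measure; rewrite ?inE; [|exact: mA|exact: subIsetl].
  by apply: measurableI; [exact: mA|exact: measurable_itv].
rewrite /A lebesgue_measure_itv/= lte_fin ltr_pM2r ?invr_gt0// ltr_nat ltnSn.
by rewrite -EFinB lee_fin -mulrBl -natrB// subSn// subnn mul1r.
Qed.

(** * Cost of one row of cells *)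

(* Cells are indexed from 0, so cell i is bounded by i / N and i.+1 / N.  The
   junk value X = N^2 / 0 = 0 (first cell of the other coordinate) costs 0. *)
Definition jump_cost {R : realType} (X : R) (i : nat) : R :=
  if i%:R ^+ 2 < 2 * X then 1 else
    (Num.floor (X / i%:R) - Num.floor (X / i.+1%:R))%:~R
      + 2 * (X / i%:R - X / i.+1%:R) ^+ 2.

Lemma jump_cost0 {R : realType} (i : nat) : jump_cost (0 : R) i = 0.
Proof.
by rewrite /jump_cost mulr0 ltNge sqr_ge0/= !mul0r !subrr add0r expr0n mulr0.
Qed.

Lemma jump_cost_ge0 {R : realType} (X : R) (i : nat) :
  0 <= X -> 0 <= jump_cost X i.
Proof.
rewrite le_eqVlt => /predU1P[<-|X0]; first by rewrite jump_cost0.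
rewrite /jump_cost; case: ltP => //; case: i => [|i].
  by rewrite expr0n/= pmulr_rle0// leNgt X0.
move=> _; apply: addr_ge0; last by rewrite mulr_ge0 ?sqr_ge0.
rewrite ler0z subr_ge0; apply: le_floor.
by rewrite ler_pM2l// lef_pV2 ?posrE ?ltr0n// ler_nat.
Qed.

(** With [t = sqrt (2 X)], the indices below [t] cost 1 each and number at most [t + 1]; from the
    first [q >= t] on, the costs telescope to at most [Phi q <= 2 / 3 * t]. *)
Lemma sum_jump_cost_le {R : realType} (X : R) (n : nat) : 0 <= X ->
  \sum_(i < n) jump_cost X i <= 5 / 3 * Num.sqrt (2 * X) + 1.
Proof.
rewrite le_eqVlt => /predU1P[<-|X0].
  by rewrite big1 ?mulr0 ?sqrtr0 ?mulr0 ?add0r// => i _; exact: jump_cost0.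
set t := Num.sqrt (2 * X).
have t0 : 0 < t by rewrite sqrtr_gt0 mulr_gt0.
have t2 : t ^+ 2 = 2 * X by rewrite sqr_sqrtr// ltW// mulr_gt0.
have EX : X = t ^+ 2 / 2 by rewrite t2; field.
(* The last term comes from 3 (a b)^2 <= a^3 - b^3 for a = 1/p, b = 1/(p+1). *)
pose Phi (p : nat) : R :=
  (Num.floor (X / p%:R))%:~R + 2 / 3 * X ^+ 2 / p%:R ^+ 3.
have Phi0 p : 0 <= Phi p.
  apply: addr_ge0; first by rewrite ler0z floor_ge0 divr_ge0// ltW.
  by rewrite divr_ge0 ?exprn_ge0// mulr_ge0 ?sqr_ge0// divr_ge0.
have Phi_le q : t <= q%:R -> Phi q <= 2 / 3 * t.
  move=> tq; have q0 := lt_le_trans t0 tq.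
  have tq1 : t / q%:R <= 1 by rewrite ler_pdivrMr// mul1r.
  have r0 : 0 <= t / q%:R by rewrite divr_ge0// ltW.
  rewrite /Phi (le_trans (lerD (floor_le _) (lexx _)))// EX.
  (* With [r = t / q <= 1], the bracket [r / 2 + r ^+ 3 / 6] is at most [1 / 2 + 1 / 6 = 2 / 3]. *)
  have -> : t ^+ 2 / 2 / q%:R + 2 / 3 * (t ^+ 2 / 2) ^+ 2 / q%:R ^+ 3 =
    t * (t / q%:R / 2 + (t / q%:R) ^+ 3 / 6) by field; rewrite gt_eqF.
  rewrite [leRHS]mulrC ler_pM2l//.
  have : (t / q%:R) ^+ 3 <= 1 by exact: exprn_ile1.
  by move: tq1; lra.
have Phi_step p : (0 < p)%N -> t <= p%:R ->
    jump_cost X p <= Phi p - Phi p.+1.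
  move=> p0 tp; have pR : 0 < p%:R :> R by rewrite ltr0n.
  rewrite /jump_cost ltNge -t2 (ler_pXn2r _ (ltW t0) (ltW pR))// tp/=.
  rewrite /Phi intrB.
  set f := _%:~R; set g := _%:~R.
  have p1 : 0 < 1 + p%:R :> R by lra.
  have -> : p.+1%:R = p%:R + 1 :> R by rewrite natr1.
  have -> : X / p%:R - X / (p%:R + 1) = X / (p%:R * (p%:R + 1)).
    by field; rewrite !gt_eqF// addrC.
  suff : 2 * (X / (p%:R * (p%:R + 1))) ^+ 2 <=
      2 / 3 * X ^+ 2 / p%:R ^+ 3 - 2 / 3 * X ^+ 2 / (p%:R + 1) ^+ 3 by lra.
  have -> : 2 / 3 * X ^+ 2 / p%:R ^+ 3 - 2 / 3 * X ^+ 2 / (p%:R + 1) ^+ 3 =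
     2 * (X / (p%:R * (p%:R + 1))) ^+ 2 +
     2 / 3 * (X / (p%:R * (p%:R + 1))) ^+ 2 / (p%:R * (p%:R + 1)).
    by field; rewrite !gt_eqF// addrC.
  rewrite lerDl; apply: divr_ge0; apply: mulr_ge0; rewrite ?sqr_ge0//; lra.
(* Both clauses apply at the first [p >= t], where counting hands over to telescoping. *)
have main p : (p%:R < t + 1 -> \sum_(i < p) jump_cost X i <= p%:R) /\
    (t <= p%:R -> \sum_(i < p) jump_cost X i <= 5 / 3 * t + 1 - Phi p).
  elim: p => [|p [IH1 IH2]].
    by rewrite big_ord0; split => //; rewrite leNgt t0.
  have Ep : p.+1%:R = p%:R + 1 :> R by rewrite natr1.
  rewrite big_ord_recr/= Ep.
  have [tp|pt] := leP t p%:R.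
    split; first by rewrite ltrD2r ltNge tp.
    move=> _; have p0 : (0 < p)%N by rewrite -(ltr_nat R) (lt_le_trans t0).
    by have := IH2 tp; have := Phi_step p p0 tp; lra.
  have S1 : \sum_(i < p) jump_cost X i + jump_cost X p <= p%:R + 1.
    rewrite lerD// ?IH1//; first lra.
    by rewrite /jump_cost -t2 (ltr_pXn2r _ (ler0n _ _) (ltW t0))// pt.
  by split => // tp; have := Phi_le p.+1; rewrite Ep => /(_ tp); lra.
have [n1 n2] := main n.
have [tn|nt] := leP t n%:R; first by have := n2 tn; have := Phi0 n; lra.
by have := n1 _; lra.
Qed.

(** * Pointwise bound on a cell *)

Lemma ceil_cell {R : realType} {N i : nat} {x : R} : (0 < N)%N ->
  i%:R / N%:R < x <= i.+1%:R / N%:R -> Num.ceil (N%:R * x) = i.+1.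
Proof.
move=> N0; have NR : 0 < N%:R :> R by rewrite ltr0n.
rewrite ltr_pdivrMr// ler_pdivlMr// ![x * _]mulrC => xi; apply: ceil_def.
by rewrite -[i.+1%:Z]/(1 + i%:Z) addrAC subrr add0r.
Qed.

Lemma sub_frac_part_sqr_le1 {R : realType} (u v : R) :
  (frac_part u - frac_part v) ^+ 2 <= 1.
Proof.
have /andP[] := floor_itv u; have /andP[] := floor_itv v.
rewrite /frac_part !intrD => *; set d := _ - _ - _.
have : -1 <= d <= 1 by rewrite /d; lra.
nra.
Qed.

(** If [v] and [w] have the same floor, so does [u], and the difference is [u - v <= w - v].
    Otherwise an integer is crossed and the floor term alone covers the trivial bound 1. *)
Lemma sub_frac_part_sqr_le {R : realType} {u v w : R} : v <= u <= w ->
  (frac_part u - frac_part v) ^+ 2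
    <= (Num.floor w - Num.floor v)%:~R + (w - v) ^+ 2.
Proof.
move=> /andP[vu uw]; have fvu := le_floor vu; have fuw := le_floor uw.
have [e|ne] := eqVneq (Num.floor v) (Num.floor w).
  have fu : Num.floor u = Num.floor v.
    by apply/eqP; rewrite eq_le fvu andbT e fuw.
  rewrite /frac_part fu -e subrr add0r opprB addrA subrK.
  by rewrite ler_pXn2r ?nnegrE ?subr_ge0 ?(le_trans vu)// lerD2r.
apply: le_trans (sub_frac_part_sqr_le1 u v) _.
rewrite -[leLHS]addr0 lerD ?sqr_ge0// ler1z.
by rewrite -gtz0_ge1 subr_gt0 lt_neqAle ne (le_trans fvu).
Qed.

Lemma kernelK_ddagger_cell_le {R : realType} (N : nat) (i j : 'I_N) (x y : R) :
  i%:R / N%:R < x <= i.+1%:R / N%:R -> j%:R / N%:R < y <= j.+1%:R / N%:R ->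
  kernelK_ddagger N x y ^+ 2
    <= jump_cost (N%:R ^+ 2 / j.+1%:R) i + jump_cost (N%:R ^+ 2 / i%:R) j.
Proof.
move=> xi yj; have N0 : (0 < N)%N := leq_ltn_trans (leq0n i) (ltn_ord i).
have NR : 0 < N%:R :> R by rewrite ltr0n.
have x0 : 0 < x.
  by case/andP: xi => + _; apply: le_lt_trans; rewrite divr_ge0.
have y0 : 0 < y.
  by case/andP: yj => + _; apply: le_lt_trans; rewrite divr_ge0.
rewrite /kernelK_ddagger /kernelK /kernelK_dagger x0 y0/=.
rewrite (ceil_cell N0 xi) (ceil_cell N0 yj).
set u := 1 / (x * y); set v := N%:R ^+ 2 / _.
have -> : (2^-1 - frac_part u - (2^-1 - frac_part v)) ^+ 2 =
    (frac_part u - frac_part v) ^+ 2 by ring.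
have P1 : 0 <= jump_cost (N%:R ^+ 2 / j.+1%:R : R) i.
  by apply: jump_cost_ge0; rewrite divr_ge0 ?sqr_ge0.
have P2 : 0 <= jump_cost (N%:R ^+ 2 / i%:R : R) j.
  by apply: jump_cost_ge0; rewrite divr_ge0 ?sqr_ge0.
(* A cost in its trivial regime equals 1 and suffices, the other cost being nonnegative. *)
have D1 := sub_frac_part_sqr_le1 u v.
rewrite /jump_cost in P1 P2 *; move: P1 P2.
case: ifPn => [_ _ P2|c1 +]; first by rewrite (le_trans D1)// lerDl.
case: ifPn => [_ P1 _|c2 _ _]; first by rewrite (le_trans D1)// lerDr.
(* Index 0 always falls in the trivial regime when [X > 0]; [i0] comes first because it makes
   [N ^+ 2 / i] positive for [j0]. *)
have i0 : (0 < i)%N.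
  rewrite lt0n; apply: contraNneq c1 => ->.
  by rewrite expr0n/= mulr_gt0// divr_gt0// exprn_gt0.
have j0 : (0 < j)%N.
  rewrite lt0n; apply: contraNneq c2 => ->.
  by rewrite expr0n/= mulr_gt0// divr_gt0 ?exprn_gt0// ltr0n.
have iR : 0 < i%:R :> R by rewrite ltr0n.
have jR : 0 < j%:R :> R by rewrite ltr0n.
(* [v'] is the value at the intermediate corner [(i / N, j.+1 / N)]: the first cost pays for [v] to
   [v'], the second for [v'] to [w]. *)
set v' := N%:R ^+ 2 / j.+1%:R / i%:R.
set w := N%:R ^+ 2 / i%:R / j%:R.
have -> : N%:R ^+ 2 / j.+1%:R / i.+1%:R = v.
  by rewrite /v -mulrA -invfM mulrC [X in X^-1]mulrC mulrC.
have -> : N%:R ^+ 2 / i%:R / j.+1%:R = v' by rewrite mulrAC.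
have vuw : v <= u <= w.
  have -> : v = (i.+1%:R / N%:R * (j.+1%:R / N%:R))^-1.
    by rewrite /v -!pmulrn !invfM !invrK; ring.
  have -> : w = (i%:R / N%:R * (j%:R / N%:R))^-1.
    by rewrite /w !invfM !invrK; ring.
  case/andP: xi => /ltW xl xr; case/andP: yj => /ltW yl yr.
  rewrite /u div1r !lef_pV2 ?posrE ?mulr_gt0 ?invr_gt0//.
  by rewrite !ler_pM ?mulr_ge0 ?invr_ge0 ?(ltW x0) ?(ltW y0).
apply: le_trans (sub_frac_part_sqr_le vuw) _.
rewrite !intrB.
(* The floors telescope through [v'], and [(a + b) ^+ 2 <= 2 * a ^+ 2 + 2 * b ^+ 2] explains the
   factor 2 in [jump_cost]. *)
have := sqr_ge0 (v' - v - (w - v')).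
nra.
Qed.

(** * Summation over all rows *)

(** The [- 1] is kept so that, multiplied by [k >= N], it absorbs the additive 1 of each of the [N]
    rows. *)
Lemma sum_inv_sqrt_le {R : realType} (n : nat) :
  \sum_(i < n.+1) (Num.sqrt i.+1%:R)^-1 <= 2 * Num.sqrt n.+1%:R - 1 :> R.
Proof.
elim: n => [|n IH]; first by rewrite big_ord1 sqrtr1 invr1; lra.
rewrite big_ord_recr/=; apply: le_trans (lerD IH (lexx _)) _.
set a := Num.sqrt n.+1%:R; set b := Num.sqrt n.+2%:R.
have b0 : 0 < b by rewrite sqrtr_gt0.
have a0 : 0 < a by rewrite sqrtr_gt0.
have ab : b ^+ 2 = a ^+ 2 + 1 by rewrite !sqr_sqrtr// natr1.
suff : b^-1 <= 2 * b - 2 * a by lra.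
rewrite -[leLHS]mul1r ler_pdivrMr//.
have := sqr_ge0 (b - a); nra.
Qed.

Lemma sum_sum_jump_cost_le {R : realType} (N : nat) : (0 < N)%N ->
  \sum_(j < N) \sum_(i < N)
     (jump_cost (N%:R ^+ 2 / j.+1%:R) i + jump_cost (N%:R ^+ 2 / i%:R) j)
  <= 20 / 3 * Num.sqrt 2 * N%:R * Num.sqrt N%:R :> R.
Proof.
case: N => // n _; set N := n.+1; pose k : R := 5 / 3 * Num.sqrt 2 * N%:R.
have q2 : 1 <= Num.sqrt 2 :> R by rewrite -[leLHS]sqrtr1 ler_wsqrtr// ler1n.
have k0 : N%:R <= k by rewrite /k -[leLHS]mul1r ler_pM2r ?ltr0n//; lra.
have cost q : \sum_(p < N) jump_cost (N%:R ^+ 2 / q%:R) p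
    <= k * (Num.sqrt q%:R)^-1 + 1 :> R.
  apply: le_trans (sum_jump_cost_le _ _ _) _.
    by rewrite divr_ge0 ?sqr_ge0.
  rewrite mulrA sqrtrM ?mulr_ge0 ?sqr_ge0// sqrtrM// sqrtr_sqr ger0_norm//.
  by rewrite sqrtrV// /k !mulrA.
under eq_bigr do rewrite big_split/=.
rewrite big_split/= [X in _ + X]exchange_big/=.
have S := @sum_inv_sqrt_le R n.
have k0' : 0 <= k by apply: le_trans k0.
have A1 : \sum_(j < N) \sum_(i < N) jump_cost (N%:R ^+ 2 / j.+1%:R) i <=
    k * (2 * Num.sqrt N%:R - 1) + N%:R :> R.
  apply: le_trans (ler_sum _ (fun (j : 'I_N) _ => cost j.+1)) _.
  rewrite big_split/= -mulr_sumr sumr_const card_ord lerD2r.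
  exact: ler_wpM2l.
have A2 : \sum_(j < N) \sum_(i < N) jump_cost (N%:R ^+ 2 / j%:R) i <=
    k * (2 * Num.sqrt N%:R - 1) + N%:R :> R.
  apply: le_trans (ler_sum _ (fun (j : 'I_N) _ => cost j)) _.
  rewrite big_split/= -mulr_sumr sumr_const card_ord lerD2r.
  apply: ler_wpM2l => //; apply: le_trans S.
  (* The term at index 0 is [1 / sqrt 0 = 0]; the rest is the sum [S] short of its last term. *)
  rewrite big_ord_recl sqrtr0 invr0 add0r big_ord_recr/= lerDl.
  by rewrite invr_ge0 sqrtr_ge0.
apply: le_trans (lerD A1 A2) _.
have -> : 20 / 3 * Num.sqrt 2 * N%:R * Num.sqrt N%:R = 4 * k * Num.sqrt N%:R.
  by rewrite /k; lra.
lra.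
Qed.

(** * Bounds for the squared norm *)

Lemma kernel_norm_sqr {R : realType} (K : R -> R -> R) :
  (kernel_norm K ^+ 2 = \int[lebesgue_measure]_(y in `[0%R, 1%R])
      \int[lebesgue_measure]_(x in `[0%R, 1%R]) (K x y ^+ 2)%:E)%E.
Proof.
rewrite /kernel_norm; set I := integral _ _ _.
have I0 : (0 <= I)%E.
  apply: integral_ge0 => y _; apply: integral_ge0 => x _.
  by rewrite lee_fin sqr_ge0.
by rewrite poweR12_sqrt// sqr_sqrte.
Qed.

Lemma kernelK_ddagger0l {R : realType} (N : nat) (y : R) :
  kernelK_ddagger N 0 y = 0.
Proof.
by rewrite /kernelK_ddagger /kernelK /kernelK_dagger ltxx subrr.
Qed.

Lemma kernelK_ddagger0r {R : realType} (N : nat) (x : R) :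
  kernelK_ddagger N x 0 = 0.
Proof.
by rewrite /kernelK_ddagger /kernelK /kernelK_dagger ltxx andbF subrr.
Qed.

(** The one-dimensional bound is applied in [x] for fixed [y], then in [y]; the kernel vanishes on
    both axes, as that bound requires at 0. *)
Lemma kernel_norm_ddagger_step_le {R : realType} (N : nat)
    (c : nat -> nat -> R) : (0 < N)%N -> (forall i j, 0 <= c i j) ->
  (forall (i j : 'I_N) (x y : R),
     i%:R / N%:R < x <= i.+1%:R / N%:R -> j%:R / N%:R < y <= j.+1%:R / N%:R ->
     kernelK_ddagger N x y ^+ 2 <= c i j) ->
  (kernel_norm (@kernelK_ddagger R N) ^+ 2
     <= ((\sum_(j < N) \sum_(i < N) c i j) / N%:R ^+ 2)%:E)%E.
Proof.
move=> N0 c0 Kc; rewrite kernel_norm_sqr.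
have K0 x y : (0 <= (@kernelK_ddagger R N x y ^+ 2)%:E)%E.
  by rewrite lee_fin sqr_ge0.
apply: le_trans (@integral_unit_itv_step_le R N _
  (fun j => (\sum_(i < N) c i j) / N%:R) N0 _ _ _ _) _.
- by move=> y; apply: integral_ge0.
- by apply: integral0_eq => x _; rewrite kernelK_ddagger0r expr0n.
- by move=> j; rewrite divr_ge0 ?sumr_ge0.
- move=> j y yj; apply: (@integral_unit_itv_step_le R N
    (fun x => (kernelK_ddagger N x y ^+ 2)%:E) (fun i => c i j) N0) => //.
    by rewrite kernelK_ddagger0l expr0n.
  by move=> i x xi; rewrite lee_fin Kc.
- by rewrite -mulr_suml -mulrA -invfM.
Qed.

Lemma kernel_norm_ddagger_le1 {R : realType} (N : nat) : (0 < N)%N ->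
  (kernel_norm (@kernelK_ddagger R N) ^+ 2 <= 1)%E.
Proof.
move=> N0; have NR : N%:R != 0 :> R by rewrite pnatr_eq0 -lt0n.
apply: le_trans
  (@kernel_norm_ddagger_step_le R N (fun _ _ => 1) N0 _ _) _ => //.
  move=> i j x y _ _; rewrite /kernelK_ddagger /kernelK /kernelK_dagger.
  case: ifP => _; last by rewrite subrr expr0n.
  set u := frac_part _; set v := frac_part _.
  rewrite (_ : _ - _ = v - u); last by ring.
  exact: sub_frac_part_sqr_le1.
rewrite lee_fin !sumr_const !card_ord -[X in X / _]mulr_natr expr2.
by rewrite mulfV// mulf_neq0.
Qed.

Lemma kernel_norm_ddagger_le {R : realType} (N : nat) : (0 < N)%N ->
  (kernel_norm (@kernelK_ddagger R N) ^+ 2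
     <= (20 / 3 * Num.sqrt 2 / Num.sqrt N%:R)%:E)%E.
Proof.
move=> N0; have NR : 0 < N%:R :> R by rewrite ltr0n.
pose c (i j : nat) : R :=
  jump_cost (N%:R ^+ 2 / j.+1%:R) i + jump_cost (N%:R ^+ 2 / i%:R) j.
apply: le_trans (@kernel_norm_ddagger_step_le R N c N0 _
  (@kernelK_ddagger_cell_le R N)) _.
  move=> i j; apply: addr_ge0; apply: jump_cost_ge0;
  by rewrite divr_ge0 ?sqr_ge0.
rewrite lee_fin ler_pdivrMr ?exprn_gt0//.
apply: le_trans (@sum_sum_jump_cost_le R N N0) _.
have s0 : 0 < Num.sqrt N%:R :> R by rewrite sqrtr_gt0.
have sE : N%:R = Num.sqrt N%:R ^+ 2 :> R by rewrite sqr_sqrtr// ltW.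
rewrite {1 4}sE le_eqVlt; apply/orP; left; apply/eqP; field.
by rewrite gt_eqF.
Qed.

(** * Numerical comparison with the claimed bound *)

Lemma expR1_le3 {R : realType} : expR 1 <= 3 :> R.
Proof.
have h : 5 / 6 <= expR (- (1 / 6)) :> R.
  by have := @expR_ge1Dx R (- (1 / 6)); lra.
(* [(5 / 6) ^+ 6 = 15625 / 46656] just exceeds [1 / 3]. *)
have : (5 / 6) ^+ 6 <= expR (- 1) :> R.
  rewrite (_ : - 1 = 6%:R * - (1 / 6)); last by field.
  by rewrite expRM_natl lerXn2r ?nnegrE// ?expR_ge0//; lra.
have := expRxMexpNx_1 (1 : R); have := expR_gt0 (1 : R).
nra.
Qed.

Lemma ln_ge {R : realType} (a x : R) : expR a <= x -> a <= ln x.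
Proof.
move=> ax; have x0 := lt_le_trans (expR_gt0 a) ax.
by rewrite -ler_expR lnK.
Qed.

(** Here [a] and [c] are rational lower bounds for [ln N] and [ln (ln N)], and [b ^+ 2] exceeds
    [8 * (9 + c)] by an exact square. Of the middle term only [4 / 9] is kept. *)
Lemma bound_factor_ge {R : realType} (N : nat) (a c : R) :
  0 < a -> expR a <= N%:R -> 0 <= c -> expR c <= a ->
  exists2 b : R, 0 <= b /\ 8 * (9 + c) <= b ^+ 2 &
  b + 4 / 9 <= 2 * Num.sqrt (ln N%:R)
     + (1 + 1 / Num.sqrt N%:R) ^+ 8
       * (4 / 9 + 23 / 30 * N%:R `^ (- (1 / 6)))
     + (ln (ln N%:R) + 9) / Num.sqrt (ln N%:R).
Proof.
move=> a0 aN c0 ca; have aL : a <= ln N%:R by exact: ln_ge.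
have L0 := lt_le_trans a0 aL; have cL : c <= ln (ln N%:R).
  by apply: ln_ge; apply: le_trans aL.
set s := Num.sqrt (ln _).
have s0 : 0 < s by rewrite sqrtr_gt0.
exists (2 * s + (c + 9) / s); first split.
- by rewrite addr_ge0 ?mulr_ge0 ?divr_ge0 ?addr_ge0 ?invr_ge0// ltW.
- rewrite (_ : _ ^+ 2 = 8 * (9 + c) + (2 * s - (c + 9) / s) ^+ 2).
    by rewrite lerDl sqr_ge0.
  by field; rewrite gt_eqF.
- have h1 : (c + 9) / s <= (ln (ln N%:R) + 9) / s.
    by rewrite ler_pM2r ?invr_gt0// lerD2r.
  have h2 : 1 <= (1 + 1 / Num.sqrt N%:R) ^+ 8 :> R.
    by rewrite exprn_ege1// lerDl divr_ge0 ?sqrtr_ge0.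
  have h3 : 0 <= N%:R `^ (- (1 / 6)) :> R by exact: powR_ge0.
  set p := _ `^ _ in h3 *; set q := _ ^+ 8 in h2 *.
  nra.
Qed.

Theorem theorem1 (R : realType) (N : nat) (hN : (25 <= N)%N) :
  (kernel_norm (@kernelK_ddagger R N) ^+ 2 <
   ((2 * Num.sqrt (ln N%:R)
     + (1 + 1 / Num.sqrt N%:R) ^+ 8
       * (4 / 9 + 23 / 30 * N%:R `^ (- (1 / 6)))
     + (ln (ln N%:R) + 9) / Num.sqrt (ln N%:R))
    * N%:R `^ (- (1 / 2)))%R%:E)%E.
Proof.
have N0 : (0 < N)%N by apply: leq_trans hN.
have NR : 0 < N%:R :> R by rewrite ltr0n.
have e3 := @expR1_le3 R; have e0 := expR_gt0 (1 : R).
have -> : N%:R `^ (- (1 / 2)) = (Num.sqrt N%:R)^-1 :> R.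
  by rewrite powRN div1r powR12_sqrt ?ltW.
have s0 : 0 < Num.sqrt N%:R :> R by rewrite sqrtr_gt0.
have sE : Num.sqrt N%:R ^+ 2 = N%:R :> R by rewrite sqr_sqrtr// ltW.
have expRn n : expR n%:R <= 3 ^+ n :> R.
  rewrite -[n%:R]mulr1 expRM_natl lerXn2r ?nnegrE ?expR_ge0//.
have [N81|N81] := leqP 81 N.
  (* From [e <= 3]: [e ^ 4 <= 81] and [e ^ 5 <= 243 <= 4 ^ 4]. Then [b ^+ 2 >= 82], so
     [b + 4 / 9 > 9.49], while [20 / 3 * sqrt 2 < 9.43]. *)
  have [||||b [b0 b2] bE] := @bound_factor_ge R N 4 (5 / 4) => //.
  - by apply: le_trans (expRn 4%N) _; rewrite -natrX ler_nat.
  - have : expR (5 / 4) ^+ 4 <= 4 ^+ 4 :> R.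
      rewrite -expRM_natl (_ : _ * _ = 5%:R); last by field.
      by apply: le_trans (expRn 5%N) _; rewrite -!natrX ler_nat.
    by rewrite ler_pXn2r ?nnegrE ?expR_ge0.
  apply: le_lt_trans (kernel_norm_ddagger_le N N0) _.
  rewrite lte_fin ltr_pM2r ?invr_gt0//; apply: lt_le_trans bE.
  have q2 : Num.sqrt 2 ^+ 2 = 2 :> R by rewrite sqr_sqrtr.
  have q0 : 0 <= Num.sqrt 2 :> R by rewrite sqrtr_ge0.
  have : 905 / 100 < b by nra.
  have : Num.sqrt 2 < 14143 / 10000 :> R by nra.
  lra.
(* Now [e ^ 2 <= 9 <= N] and [e <= 4], so [b ^+ 2 >= 76] and [b + 4 / 9 > 9 >= sqrt N]. *)
have [||||b [b0 b2] bE] := @bound_factor_ge R N 2 (1 / 2) => //.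
- by apply: le_trans (expRn 2%N) _; rewrite -natrX ler_nat (leq_trans _ hN).
- have : expR (1 / 2) ^+ 2 <= 2 ^+ 2 :> R.
    rewrite -expRM_natl (_ : _ * _ = 1); last by field.
    by apply: le_trans e3 _; rewrite -natrX ler_nat.
  by rewrite ler_pXn2r ?nnegrE ?expR_ge0.
apply: le_lt_trans (kernel_norm_ddagger_le1 N N0) _.
rewrite lte_fin ltr_pdivlMr// (mul1r (Num.sqrt N%:R)); apply: lt_le_trans bE.
have N81R : N%:R <= 81 :> R by rewrite ler_nat ltnW.
have : Num.sqrt N%:R <= 9 :> R by nra.
have : 87 / 10 < b by nra.
lra.
Qed.
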